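(* No non-trivial element of $\operatorname{Aut}_c(P_n)$ can be extended to an automorphism of $B_n$.
   Context: For $n\ge 2$, $B_n$ is the Artin braid group on $n$ strings with standard generators $\sigma_1,\dots,\sigma_{n-1}$, and $P_n$ is the pure braid group, the kernel of the natural homomorphism $B_n\to S_n$, $\sigma_i\mapsto(i\ i+1)$, onto the symmetric group. An automorphism of a group $G$ is called central if it induces the identity automorphism on $G/Z(G)$, where $Z(G)$ is the center of $G$; $\operatorname{Aut}_c(G)$ is the group of central automorphisms of $G$. An automorphism of $P_n$ extends to $B_n$ if it is the restriction to $P_n$ of some automorphism of $B_n$.
   Formalization: The result is stated for n ≥ 3 instead of n ≥ 2: for n = 2 it is false, since P_2 is infinite cyclic, so inversion is a non-trivial central automorphism of P_2, and it extends to inversion on B_2. *)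

(* Defs.v *)
From HB Require Import structures.
From mathcomp Require Import all_boot fingroup perm.
From mathcomp Require Import boolp classical_sets.

Set Implicit Arguments.
Unset Strict Implicit.
Unset Printing Implicit Defensive.

Local Open Scope classical_set_scope.
Local Open Scope quotient_scope.
Local Open Scope group_scope.

Section BraidGroup.

Variable n : nat.

(* The letter (i, false) stands for the generator sigma_(i+1), and (i, true)
   for its inverse; generators and strings are numbered from 0. *)
Definition braid_word : Type := seq ('I_n.-1 * bool).
HB.instance Definition _ := Choice.on braid_word.

Implicit Types (u v w : braid_word) (i j : 'I_n.-1).

Inductive braid_eq : braid_word -> braid_word -> Prop :=
| braid_eq_refl u : braid_eq u u
| braid_eq_sym u v : braid_eq u v -> braid_eq v u
| braid_eq_trans v u w : braid_eq u v -> braid_eq v w -> braid_eq u w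
| braid_eq_cat u1 u2 v1 v2 :
    braid_eq u1 v1 -> braid_eq u2 v2 -> braid_eq (u1 ++ u2) (v1 ++ v2)
| braid_eq_cancel i b : braid_eq [:: (i, b); (i, ~~ b)] [::]
| braid_eq_far i j : i.+1 < j ->
    braid_eq [:: (i, false); (j, false)] [:: (j, false); (i, false)]
| braid_eq_near i j : j = i.+1 :> nat ->
    braid_eq [:: (i, false); (j, false); (i, false)]
             [:: (j, false); (i, false); (j, false)].

Definition braid_eqb u v : bool := `[< braid_eq u v >].

Lemma braid_eqb_refl : reflexive braid_eqb.
Proof. by move=> u; apply/asboolP; exact: braid_eq_refl. Qed.

Lemma braid_eqb_sym : symmetric braid_eqb.
Proof. by move=> u v; apply/asboolP/asboolP; exact: braid_eq_sym. Qed.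

Lemma braid_eqb_trans : transitive braid_eqb.
Proof.
move=> v u w /asboolP uv /asboolP vw; apply/asboolP.
exact: braid_eq_trans vw.
Qed.

Canonical braid_equiv :=
  EquivRel braid_eqb braid_eqb_refl braid_eqb_sym braid_eqb_trans.

Definition braid : Type := {eq_quot braid_equiv}.
HB.instance Definition _ := Choice.on braid.

Definition braid_of (w : braid_word) : braid := \pi_({eq_quot braid_equiv}) w.
Definition word_of (b : braid) : braid_word := generic_quotient.repr (b : {eq_quot braid_equiv}).

Lemma word_ofK : cancel word_of braid_of.
Proof. by move=> b; exact: reprK. Qed.

Lemma braid_ofP u v : braid_of u = braid_of v <-> braid_eq u v.
Proof.
split=> [/eqmodP /asboolP //|uv].
by apply/eqmodP/asboolP.
Qed.

Lemma braid_of_eq u v : braid_eq u v -> braid_of u = braid_of v.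
Proof. by move/braid_ofP. Qed.

Lemma word_of_eq w : braid_eq (word_of (braid_of w)) w.
Proof. by apply/braid_ofP; rewrite word_ofK. Qed.

Definition inv_word w : braid_word := rev [seq (l.1, ~~ l.2) | l <- w].

Lemma inv_wordK w : inv_word (inv_word w) = w.
Proof.
rewrite /inv_word map_rev revK -map_comp map_id_in // => -[i b] _ /=.
by rewrite negbK.
Qed.

Lemma braid_eq_mulV w : braid_eq (w ++ inv_word w) [::].
Proof.
elim: w => [|[i b] w IHw]; first exact: braid_eq_refl.
have -> : ((i, b) :: w) ++ inv_word ((i, b) :: w)
    = [:: (i, b)] ++ ((w ++ inv_word w) ++ [:: (i, ~~ b)]).
  by rewrite /inv_word /= rev_cons -cats1 catA.
apply: (@braid_eq_trans ([:: (i, b)] ++ ([::] ++ [:: (i, ~~ b)]))); last first.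
  exact: braid_eq_cancel.
apply: braid_eq_cat; first exact: braid_eq_refl.
by apply: braid_eq_cat; [exact: IHw | exact: braid_eq_refl].
Qed.

Lemma braid_eq_Vmul w : braid_eq (inv_word w ++ w) [::].
Proof. by rewrite -{2}(inv_wordK w); exact: braid_eq_mulV. Qed.

Lemma braid_eq_inv u v : braid_eq u v -> braid_eq (inv_word u) (inv_word v).
Proof.
move=> uv; have vV := braid_eq_mulV v.
apply: (@braid_eq_trans (inv_word u ++ (v ++ inv_word v))).
  rewrite -{1}(cats0 (inv_word u)).
  by apply: braid_eq_cat; [exact: braid_eq_refl | exact: braid_eq_sym].
rewrite catA -{2}(cat0s (inv_word v)).
apply: braid_eq_cat; last exact: braid_eq_refl.
apply: braid_eq_trans (braid_eq_Vmul u).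
by apply: braid_eq_cat; [exact: braid_eq_refl | exact: braid_eq_sym].
Qed.

Definition braid_mul (a b : braid) : braid := braid_of (word_of a ++ word_of b).
Definition braid_one : braid := braid_of [::].
Definition braid_inv (a : braid) : braid := braid_of (inv_word (word_of a)).

Lemma braid_mulE u v : braid_mul (braid_of u) (braid_of v) = braid_of (u ++ v).
Proof. by apply: braid_of_eq; apply: braid_eq_cat; exact: word_of_eq. Qed.

Lemma braid_invE u : braid_inv (braid_of u) = braid_of (inv_word u).
Proof. by apply: braid_of_eq; apply: braid_eq_inv; exact: word_of_eq. Qed.

Lemma braid_mulA : associative braid_mul.
Proof.
move=> a b c; rewrite -(word_ofK a) -(word_ofK b) -(word_ofK c).
by rewrite !braid_mulE catA.
Qed.

Lemma braid_mul1b : left_id braid_one braid_mul.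
Proof. by move=> a; rewrite -(word_ofK a) braid_mulE. Qed.

Lemma braid_mulb1 : right_id braid_one braid_mul.
Proof. by move=> a; rewrite -(word_ofK a) braid_mulE cats0. Qed.

Lemma braid_mulVb : left_inverse braid_one braid_inv braid_mul.
Proof.
move=> a; rewrite -(word_ofK a) braid_invE braid_mulE.
by apply: braid_of_eq; exact: braid_eq_Vmul.
Qed.

Lemma braid_mulbV : right_inverse braid_one braid_inv braid_mul.
Proof.
move=> a; rewrite -(word_ofK a) braid_invE braid_mulE.
by apply: braid_of_eq; exact: braid_eq_mulV.
Qed.

HB.instance Definition _ := isGroup.Build braid
  braid_mulA braid_mul1b braid_mulb1 braid_mulVb braid_mulbV.

Definition sigma i : braid := braid_of [:: (i, false)].

Lemma strand_lt i : i < n.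
Proof. by rewrite (leq_trans (ltn_ord i)) ?leq_pred. Qed.

Lemma strandS_lt i : i.+1 < n.
Proof. by case: n i => [|m] i; [case: i | rewrite ltnS; exact: ltn_ord i]. Qed.

Definition adj_tperm i : {perm 'I_n} :=
  tperm (Ordinal (strand_lt i)) (Ordinal (strandS_lt i)).

(* Permutations compose from left to right in MathComp. As the adj_tperm i are
   involutions, the opposite convention gives the same kernel. *)
Definition word_perm w : {perm 'I_n} := \prod_(l <- w) adj_tperm l.1.

Lemma adj_tperm_far i j : i.+1 < j ->
  adj_tperm i * adj_tperm j = adj_tperm j * adj_tperm i.
Proof.
move=> lij; rewrite [RHS]conjgC; congr (_ * _); rewrite tpermJ.
have lt_ij : i < j by exact: ltnW.
by rewrite !tpermD // -val_eqE /= neq_ltn ?ltnS ?lij ?lt_ij ?orbT // ltnW ?orbT.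
Qed.

Lemma adj_tperm_near i j : j = i.+1 :> nat ->
  adj_tperm i * adj_tperm j * adj_tperm i
    = adj_tperm j * adj_tperm i * adj_tperm j.
Proof.
move=> ji.
have conjE k l : adj_tperm k * adj_tperm l * adj_tperm k
    = adj_tperm l ^ adj_tperm k by rewrite conjgE tpermV mulgA.
rewrite !conjE /adj_tperm.
have -> : Ordinal (strand_lt j) = Ordinal (strandS_lt i) by apply/val_inj.
rewrite !tpermJ tpermR tpermL.
by rewrite !tpermD // -val_eqE /= ?ji neq_ltn !ltnS ?leqnSn ?leqnn ?orbT.
Qed.

Lemma word_perm_eq u v : braid_eq u v -> word_perm u = word_perm v.
Proof.
rewrite /word_perm; elim=> {u v} [u|u v _ -> |v u w _ -> _ -> |u1 u2 v1 v2 _ e1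
  _ e2|i b|i j lij|i j ji] //; rewrite ?big_cat ?e1 ?e2 ?big_cons ?big_nil //=.
- by rewrite mulg1 tperm2.
- by rewrite !mulg1 adj_tperm_far.
- by rewrite !mulg1 !mulgA adj_tperm_near.
Qed.

Definition braid_perm (b : braid) : {perm 'I_n} := word_perm (word_of b).

Lemma braid_perm_of w : braid_perm (braid_of w) = word_perm w.
Proof. by apply: word_perm_eq; exact: word_of_eq. Qed.

Lemma braid_perm_sigma i : braid_perm (sigma i) = adj_tperm i.
Proof. by rewrite braid_perm_of /word_perm big_seq1. Qed.

Lemma braid_permM : {morph braid_perm : a b / a * b}.
Proof.
move=> a b; rewrite -(word_ofK a) -(word_ofK b) [_ * _]braid_mulE.
by rewrite !braid_perm_of /word_perm big_cat.
Qed.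

Lemma braid_perm1 : braid_perm 1 = 1.
Proof. by rewrite braid_perm_of /word_perm big_nil. Qed.

HB.instance Definition _ := isUMagmaMorphism.Build braid {perm 'I_n}
  braid_perm (conj braid_perm1 braid_permM).

Definition pure_pred : {pred braid} := [pred b | braid_perm b == 1].

Lemma pure_group_closed : group_closed pure_pred.
Proof.
split=> [|a b]; first by rewrite inE braid_perm1.
rewrite !inE => /eqP ka /eqP kb.
by rewrite gmulfF /= ka kb invg1 mulg1.
Qed.

Definition pure_braid : Type := {b : braid | b \in pure_pred}.
HB.instance Definition _ := SubChoice.on pure_braid.
HB.instance Definition _ :=
  SubChoice_isSubGroup.Build braid pure_pred pure_braid pure_group_closed.

End BraidGroup.

Section Automorphisms.

Variable G : groupType.

Definition automorphism (f : G -> G) : Prop :=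
  {morph f : x y / x * y} /\ bijective f.

Definition gcenter : set G := [set z | forall x, commute z x].

Definition gcoset (x : G) (A : set G) : set G := [set x * a | a in A].

(* The map induced by f on G / Z(G) sends the coset of x to that of f x. *)
Definition central_automorphism (f : G -> G) : Prop :=
  automorphism f /\ forall x, gcoset (f x) gcenter = gcoset x gcenter.

End Automorphisms.

Definition extends_to_braid (n : nat) (f : pure_braid n -> pure_braid n) :
    Prop :=
  exists2 g : braid n -> braid n,
    automorphism g & forall x : pure_braid n, g (val x) = val (f x).

(* Main.v *)
Require Import Defs.
From HB Require Import structures.
From mathcomp Require Import all_boot all_order all_algebra fingroup perm zify.
From mathcomp Require Import boolp classical_sets.

(** Let [e : B_n -> Z] be the exponent sum, sending every generator to 1.  All
    generators are conjugate, so [e] spans the homomorphisms [B_n -> Z], and an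
    automorphism [g] of [B_n] satisfies [e (g x) = eps * e x] with [eps = 1] or
    [eps = -1] ([automorphism_expo]).  If [g] restricts on [P_n] to a central
    automorphism [f], then [f x = x * z] with [z] in [Z(P_n)] and
    [e z = (eps - 1) * e x].  Now [Z(P_n)] is generated by the full twist, whose
    exponent sum is [n * (n - 1)] ([pure_center], [expo_center]).  If [eps = 1]
    then [e z = 0], hence [z = 1] and [f x = x].  If [eps = -1], the choice
    [x = s_0 ^+ 2] gives [e z = -4], which is no multiple of [n * (n - 1) >= 6].

    The work is in the center.  Let [H_k] be generated by [s_0, ..., s_(k-1)]
    (braids on the strands [0, ..., k]) and let [U_k], generated by pure braids
    [a_(k,0), ..., a_(k,k-1)], consist of the braids in which strand [k] alone
    winds around the others.  Combing a pure braid writes the pure part of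
    [H_(k+1)] as [U_(k+1)] times the pure part of [H_k] ([parab_normal],
    [parab_cells], [pure_combed]).  If [z = u * w] is central in the pure part
    of [H_(k+1)], then for every pure [p] in [H_k] the commutator of [w] and
    [p] lies both in [U_(k+1)] and in [H_k], so it is trivial; by induction
    [w] is a power of the full twist of [H_k].  That full twist divided by the
    full twist of [H_(k+1)] lies in [U_(k+1)], so [z] is a power of the latter
    up to an element of the center of [U_(k+1)], which is trivial.

    Both triviality facts express that [U_k] is free on the [a_(k,i)].  Only
    its universal property is used: for any group [F] and elements [x_i] of [F],
    the braid group acts on sequences coloured by a rack made of [F], so that
    [a_(k,i)] multiplies the colour of strand [k] by [x_i] ([act_band]).
    Taking for [F] the semidirect product of boolean functions on [B_n] with
    [B_n] amounts to computing Fox derivatives modulo 2, and these detect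
    triviality ([bands_parab_trivial], [bands_center_trivial]). *)

Set Implicit Arguments.
Unset Strict Implicit.
Unset Printing Implicit Defensive.

Import Order.TTheory GRing.Theory Num.Theory.
Local Open Scope group_scope.

(** * Generated subgroups *)

Section Generated.

Variable G : groupType.
Implicit Types (A B : G -> Prop) (x y z : G).

Inductive gen A : G -> Prop :=
| gen_in x : A x -> gen A x
| gen_one : gen A 1
| gen_mul x y : gen A x -> gen A y -> gen A (x * y)
| gen_inv x : gen A x -> gen A x^-1.

Lemma gen_sub A B x : (forall y, A y -> gen B y) -> gen A x -> gen B x.
Proof.
move=> AB; elim=> {x} [x /AB //||x y _ Bx _ By|x _ Bx].
- exact: gen_one.
- exact: gen_mul.
- exact: gen_inv.
Qed.

Lemma gen_exp A x m : gen A x -> gen A (x ^+ m).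
Proof.
move=> Ax; elim: m => [|m IHm]; first exact: gen_one.
by rewrite expgS; apply: gen_mul.
Qed.

Lemma gen_conj A x y : gen A x -> gen A y -> gen A (y ^ x).
Proof.
by move=> Ax Ay; rewrite conjgE; do 2?apply: gen_mul => //; apply: gen_inv.
Qed.

(** Words are built one letter at a time: what coset enumerations need. *)
Lemma gen_ind_r A (P : G -> Prop) :
    P 1 -> (forall x y, P x -> A y -> P (x * y) /\ P (x * y^-1)) ->
  forall x, gen A x -> P x.
Proof.
move=> P1 PA.
suff PM y : gen A y -> forall x, P x -> P (x * y) /\ P (x * y^-1).
  by move=> x /PM/(_ _ P1) []; rewrite mul1g.
elim=> {y} [y Ay x /PA/(_ Ay) //||y z _ IHy _ IHz x Px|y _ IHy x /IHy []].
- by move=> x; rewrite invg1 mulg1.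
- rewrite invgM !mulgA; split; first by have [/IHz []] := IHy x Px.
  by have [_ /IHy []] := IHz x Px.
- by rewrite invgK.
Qed.

Lemma gen_commute A x y :
  (forall z, A z -> commute x z) -> gen A y -> commute x y.
Proof.
move=> xA; elim=> {y} [y /xA //||y z _ xy _ xz|y _ xy].
- exact: commute1.
- exact: commuteM.
- exact: commuteV.
Qed.

Lemma gen_conj_sub A B x y :
  (forall z, A z -> gen B (z ^ x)) -> gen A y -> gen B (y ^ x).
Proof.
move=> AB; elim=> {y} [y /AB //||y z _ By _ Bz|y _ By].
- by rewrite conj1g; apply: gen_one.
- by rewrite conjMg; apply: gen_mul.
- by rewrite conjVg; apply: gen_inv.
Qed.

(** Conjugation by the inverses of the generators has to be assumed too: in an
    infinite group, [B ^ x] may span a proper subgroup of the group spanned by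
    [B]. *)
Lemma gen_normal A B :
    (forall x y, A x -> B y -> gen B (y ^ x) /\ gen B (y ^ x^-1)) ->
  forall x y, gen A x -> gen B y -> gen B (y ^ x).
Proof.
move=> nAB.
suff nA x : gen A x -> forall y, gen B y -> gen B (y ^ x) /\ gen B (y ^ x^-1).
  by move=> x y Ax By; case: (nA x Ax y By).
elim=> {x} [x Ax|||x _ IHx] y.
- by split; apply: gen_conj_sub (H) => z Bz; case: (nAB x z Ax Bz).
- by rewrite invg1 conjg1.
- move=> z _ IHy _ IHz t Bt; rewrite invgM !conjgM.
  by split; [case: (IHy t Bt) => /IHz[] | case: (IHz t Bt) => _ /IHy[]].
- by rewrite invgK => /IHx[].
Qed.

Lemma commute_conj x y : commute x y -> x ^ y = x.
Proof. by move=> xy; rewrite conjgE xy mulKg. Qed.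

Lemma gen_cycle c x : gen (eq c) x -> exists m, x = c ^+ m \/ x = c ^- m.
Proof.
have cc m p : c ^+ m * c ^- p = c ^- p * c ^+ m.
  by apply/commute_sym/commute_sym/commuteV/commuteX2.
have sub m p : exists q, c ^+ m * c ^- p = c ^+ q \/ c ^+ m * c ^- p = c ^- q.
  case: (leqP p m) => [pm|/ltnW mp].
    by exists (m - p); left; rewrite -{1}(subnK pm) expgnDr mulgK.
  exists (p - m); right.
  by rewrite -{1}(subnK mp) expgnDr invgM mulgA mulgV mul1g.
elim=> {x} [_ <-||x y _ [m xE] _ [p yE]|x _ [m xE]].
- by exists 1%N; left.
- by exists 0%N; left.
- case: xE yE => -> [] ->.
  + by exists (m + p); left; rewrite expgnDr.
  + exact: sub.
  + by rewrite -cc; apply: sub.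
  + by exists (p + m); right; rewrite expgnDr invgM.
- by exists m; case: xE => ->; [right | left; rewrite invgK].
Qed.

End Generated.

(** * Combing, in any group satisfying the braid relations *)

Section BraidRelations.

Variables (G : groupType) (N : nat) (s : nat -> G).
Hypothesis s_far : forall i j, i.+1 < j -> commute (s i) (s j).
Hypothesis s_near :
  forall i, i.+1 < N -> s i * s i.+1 * s i = s i.+1 * s i * s i.+1.

Implicit Types (x y u h : G).

(** The group [H_k]: braids on the strands [0, ..., k]. *)
Definition parab k : G -> Prop := gen (fun x => exists2 i, i < k & x = s i).

(** The pure braid in which strand [k] goes past the strands between [i] and
    itself, winds once around strand [i], and comes back the same way. *)
Fixpoint band k i : G :=
  if k is k'.+1 then if i == k' then s k' ^+ 2 else band k' i ^ s k' else 1.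

(** The group [U_k]; in the braid group it is free on the [band k i], [i < k]. *)
Definition bands k : G -> Prop :=
  gen (fun x => exists2 i, i < k & x = band k i).

Lemma parab_s k i : i < k -> parab k (s i).
Proof. by move=> ik; apply: gen_in; exists i. Qed.

Lemma parab_le k l x : k <= l -> parab k x -> parab l x.
Proof.
move=> kl; apply: gen_sub => _ [i ik ->].
by apply: parab_s; apply: leq_trans kl.
Qed.

Lemma parab_commute k j x : k < j -> parab k x -> commute (s j) x.
Proof.
move=> kj; apply: gen_commute => _ [i ik ->].
by apply/commute_sym/s_far; apply: leq_ltn_trans kj.
Qed.

Lemma bandsS_sqr k : bands k.+1 (s k ^+ 2).
Proof. by apply: gen_in; exists k; rewrite //= eqxx. Qed.

Lemma bandsS_conj k u : bands k u -> bands k.+1 (u ^ s k).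
Proof.
apply: gen_conj_sub => _ [i ik ->]; apply: gen_in; exists i; first exact: ltnW.
by rewrite /= ltn_eqF.
Qed.

(** Whether the winding strand first passes its neighbour in front or behind
    does not change the group: the two passages differ by [s k ^+ 2]. *)
Lemma bandsS_conjV k u : bands k u -> bands k.+1 (u ^ (s k)^-1).
Proof.
move=> /bandsS_conj Uu; have Us := bandsS_sqr k.
suff -> : u ^ (s k)^-1 = (u ^ s k) ^ (s k ^+ 2)^-1.
  by apply: gen_conj => //; apply: gen_inv.
by rewrite expg2 invgM -conjgM mulVKg.
Qed.

Lemma band_parab k i : i < k -> parab k (band k i).
Proof.
elim: k => // k IHk ik /=; case: eqP => [_|/eqP nik].
  exact/gen_exp/parab_s.
apply: gen_conj; first exact: parab_s.
by apply: parab_le (IHk _) => //; rewrite ltn_neqAle nik.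
Qed.

Lemma bands_parab k u : bands k u -> parab k u.
Proof. by apply: gen_sub => _ [i ik ->]; apply: band_parab. Qed.

(** Strands [0, ..., k] move among themselves while strand [k.+1] winds around
    them.  All generators of [H_k] but the last one, [s], commute with the
    crossing [t] of strands [k] and [k.+1], which reduces them to a smaller
    index.  All bands but the last two are conjugates by [s * t] of braids that
    commute with [t], and the braid relation shows that [s] fixes them.  The
    last two are [t ^+ 2] and [x = (s ^+ 2) ^ t]: conjugation by [s] maps [x] to
    [t ^+ 2] and fixes [t ^+ 2 * x]. *)
Lemma parab_normal k x u :
  k < N -> parab k x -> bands k.+1 u -> bands k.+1 (u ^ x).
Proof.
move=> kN; apply: gen_normal => {x u} _ _ [j jk ->] [i ik ->].
elim: k kN j i jk ik => // k IHk kN j i jk ik.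
have {IHk} IHk l v : l < k -> bands k.+1 v ->
    bands k.+1 (v ^ s l) /\ bands k.+1 (v ^ (s l)^-1).
  move=> lk Uv; split; apply: gen_conj_sub Uv => _ [p pk ->];
  by case: (IHk _ l p lk pk) => //; apply: ltnW.
have Ut := bandsS_sqr k.+1.
move: jk; rewrite ltnS leq_eqVlt => /predU1P[->{j}|jk]; last first.
  have jt : commute (s j) (s k.+1) by apply: s_far.
  have jt2 : commute (s k.+1 ^+ 2) (s j).
    by apply/commute_sym/commuteX.
  have jtV : commute (s j)^-1 (s k.+1).
    exact/commute_sym/commuteV/commute_sym.
  have -> : band k.+2 i
      = if i == k.+1 then s k.+1 ^+ 2 else band k.+1 i ^ s k.+1.
    by [].
  case: eqP ik => [_ _|/eqP ik1 ik].
    by rewrite !commute_conj //; exact: commuteV.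
  have Ui : bands k.+1 (band k.+1 i).
    by apply: gen_in; exists i; rewrite // ltn_neqAle ik1.
  case: (IHk _ _ jk Ui) => U1 U2.
  by rewrite -!conjgM -jt -jtV !conjgM; split; apply: bandsS_conj.
have st := s_near kN.
have tVs : s k.+1 * (s k)^-1 = (s k)^-1 * (s k.+1)^-1 * s k * s k.+1.
  apply: (mulgI (s k.+1 * s k)); apply: (mulIg (s k)).
  by rewrite !mulgA mulgVK mulgK -st mulgV mul1g.
have e_s : s k ^ s k.+1 = s k.+1 ^ (s k)^-1.
  rewrite !conjgE invgK; apply: (mulgI (s k.+1)); apply: (mulIg (s k)).
  by rewrite mulVKg !mulgA mulgVK.
have e_t : s k.+1 ^ s k = s k ^ (s k.+1)^-1.
  rewrite !conjgE invgK; apply: (mulgI (s k)); apply: (mulIg (s k.+1)).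
  by rewrite mulVKg !mulgA mulgVK.
have Ux : bands k.+2 ((s k ^+ 2) ^ s k.+1) by apply/bandsS_conj/bandsS_sqr.
have -> : band k.+2 i = if i == k.+1 then s k.+1 ^+ 2 else band k.+1 i ^ s k.+1.
  by [].
case: eqP ik => [_ _|/eqP ik1 ik].
  split; rewrite conjXg ?e_t -?e_s -conjXg //.
  exact/bandsS_conjV/bandsS_sqr.
have -> : band k.+1 i = if i == k then s k ^+ 2 else band k i ^ s k by [].
case: eqP ik => [_ _|/eqP ik2 ik].
  split; first by rewrite conjXg e_s -conjXg conjgKV.
  suff -> : ((s k ^+ 2) ^ s k.+1) ^ (s k)^-1
      = (s k.+1 ^+ 2) ^ ((s k ^+ 2) ^ s k.+1) by apply: gen_conj.
  (* Both sides are one strand winding around two others, which [s k] swaps. *)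
  have e : (s k.+1 ^+ 2 * (s k ^+ 2) ^ s k.+1) ^ s k
      = s k.+1 ^+ 2 * (s k ^+ 2) ^ s k.+1.
    rewrite conjMg [X in _ * X ^ _]conjXg e_s -conjXg conjgKV conjXg e_t.
    by rewrite -conjXg !conjgE !expg2 invgK !mulgA !mulgVK mulgK.
  have eV : (s k.+1 ^+ 2) ^ (s k)^-1 = (s k ^+ 2) ^ s k.+1.
    by rewrite conjXg -e_s -conjXg.
  have e' := conjgK (s k) (s k.+1 ^+ 2 * (s k ^+ 2) ^ s k.+1).
  by rewrite [RHS]conjgE -e' e (conjMg (s k.+1 ^+ 2)) eV mulKg.
have {}ik : i < k by lia.
have Hi := band_parab ik.
have Ui : bands k (band k i) by apply: gen_in; exists i.
have it : band k i ^ s k.+1 = band k i.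
  by apply: commute_conj; apply/commute_sym/(parab_commute _ Hi).
have itV : band k i ^ (s k.+1)^-1 = band k i.
  by rewrite -{1}it conjgK.
have Uist : bands k.+2 ((band k i ^ s k) ^ s k.+1).
  by do 2!apply: bandsS_conj.
split.
  by rewrite -!conjgM mulgA st !conjgM it.
rewrite -!conjgM tVs !mulgA mulgV mul1g.
by rewrite !conjgM itV.
Qed.

(** The braids whose combing is immediate: by [parab_normal] they form a
    subgroup, in which [U_(k+1)] is normal. *)
Definition combed k x : Prop :=
  exists u h, [/\ bands k.+1 u, parab k h & x = u * h].

Lemma combed_bands k u : bands k.+1 u -> combed k u.
Proof. by exists u, 1; split; rewrite ?mulg1 //; apply: gen_one. Qed.

Lemma combed_parab k h : parab k h -> combed k h.
Proof. by exists 1, h; split; rewrite ?mul1g //; apply: gen_one. Qed.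

Lemma combedM k x y : k < N -> combed k x -> combed k y -> combed k (x * y).
Proof.
move=> kN [u [h [Uu Hh ->]]] [v [h' [Uv Hh' ->]]].
exists (u * v ^ h^-1), (h * h'); split.
- by apply: gen_mul => //; apply: parab_normal => //; apply: gen_inv.
- exact: gen_mul.
- by rewrite conjgE invgK !mulgA !mulgVK.
Qed.

(** A decomposition of [H_(k+1)] in the style of Bruhat: the subgroup of combed
    braids, and one further double coset.  The first cell fixes the end point of
    strand [k.+1] and the second one moves it. *)
Definition cells k x : Prop :=
  combed k x \/ exists q h, [/\ combed k q, parab k h & x = q * s k * h].

(** The crossing [s k] is absorbed on the right of the second cell
    [q * s k * h] by decomposing [h] in [H_k] one level down: what [h] has in
    [U_k] is conjugated into [U_(k+1)] by [s k], what it has in [H_(k-1)]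
    commutes with [s k], and a remaining [s (k-1)] is moved by the braid
    relation. *)
Lemma cells_step k : k < N ->
    (forall k', k = k'.+1 -> forall h, parab k h -> cells k' h) ->
  forall x, parab k.+1 x -> cells k x.
Proof.
move=> kN IHk; apply: gen_ind_r; first by left; apply/combed_parab/gen_one.
have Qs : combed k (s k ^+ 2) by apply/combed_bands/bandsS_sqr.
have QsV : combed k (s k ^- 2) by apply/combed_bands/gen_inv/bandsS_sqr.
move=> x _ Px [i ik ->]; move: ik; rewrite ltnS leq_eqVlt.
case/predU1P => [->{i}|ik]; last first.
  have Hs := parab_s ik.
  case: Px => [Qx|[q [h [Qq Hh ->]]]].
    by split; left; apply: combedM => //; apply: combed_parab => //;
      apply: gen_inv.
  split; right.
    by exists q, (h * s i); rewrite !mulgA; split=> //; apply: gen_mul.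
  exists q, (h * (s i)^-1); rewrite !mulgA; split=> //.
  by apply: gen_mul => //; apply: gen_inv.
case: Px => [Qx|[q [h [Qq Hh ->]]]].
  split; right; [exists x, 1|exists (x * s k ^- 2), 1].
    by split; rewrite ?mulg1 //; apply: gen_one.
  split; first exact: combedM.
    exact: gen_one.
  by rewrite mulg1 expg2 invgM !mulgA mulgVK.
case: k kN IHk Qs QsV q h Qq Hh {x} => [|k] kN IHk Qs QsV q h Qq Hh.
  have -> : h = 1 by elim: Hh => // [y [] //|y z _ -> _ ->|y _ ->];
    rewrite ?mulg1 ?invg1.
  rewrite !mulg1 -mulgA -expg2 mulgK.
  by split; left => //; apply: combedM.
have Hsub y : parab k y -> combed k.+1 y.
  by move=> Hy; apply/combed_parab/(parab_le _ Hy).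
have sH y : parab k y -> commute (s k.+1) y by apply: parab_commute.
have slide v y : bands k.+1 v -> parab k y ->
    combed k.+1 (v ^ (s k.+1)^-1 * y) /\
    s k.+1 * (v * y) = v ^ (s k.+1)^-1 * y * s k.+1.
  move=> Uv Hy; split.
    by apply: combedM => //; [apply/combed_bands/bandsS_conjV | apply: Hsub].
  by rewrite mulgA (conjgCV (s k.+1)) -!mulgA sH.
case: (IHk _ erefl _ Hh)
    => [[v [y [Uv Hy ->]]]|[_ [y' [[v [y [Uv Hy ->]]] Hy' ->]]]].
- have [Qvy e] := slide _ _ Uv Hy.
  have Qqvy := combedM kN Qq Qvy.
  rewrite -(mulgA q) e (mulgA q); split; left; last by rewrite mulgK.
  by rewrite -(mulgA (q * _)) -(expg2 (s k.+1)); apply: combedM.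
have {Qs QsV} [Qvy' e] := slide _ _ Uv Hy.
have Qqvy := combedM kN Qq Qvy'.
have Hr : parab k.+1 (s k) by apply: parab_s.
have Hry' : parab k.+1 (s k * y').
  by apply: gen_mul => //; apply: parab_le Hy'.
have sy' := sH _ Hy'.
have sy'V : (s k.+1)^-1 * y' = y' * (s k.+1)^-1.
  by apply/commute_sym/commuteV/commute_sym.
have srs : s k.+1 * s k * s k.+1 = s k * s k.+1 * s k by rewrite s_near.
have srsV : s k.+1 * s k * (s k.+1)^-1 = (s k)^-1 * s k.+1 * s k.
  apply: (mulgI (s k)); apply: (mulIg (s k.+1)).
  by rewrite !mulgA mulgVK mulgV mul1g s_near // mulgA.
split; right.
  exists (q * (v ^ (s k.+1)^-1 * y) * s k), (s k * y'); split=> //.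
    by apply: combedM => //; apply: combed_parab.
  transitivity (q * (s k.+1 * (v * y)) * (s k * (y' * s k.+1))).
    by rewrite !mulgA.
  rewrite e -sy'.
  transitivity (q * (v ^ (s k.+1)^-1 * y) * (s k.+1 * s k * s k.+1) * y').
    by rewrite !mulgA.
  by rewrite srs !mulgA.
exists (q * (v ^ (s k.+1)^-1 * y) * (s k)^-1), (s k * y'); split=> //.
  by apply: combedM => //; apply/combed_parab/gen_inv.
transitivity (q * (s k.+1 * (v * y)) * (s k * (y' * (s k.+1)^-1))).
  by rewrite !mulgA.
rewrite e -sy'V.
transitivity (q * (v ^ (s k.+1)^-1 * y) * (s k.+1 * s k * (s k.+1)^-1) * y').
  by rewrite !mulgA.
by rewrite srsV !mulgA.
Qed.

Lemma parab_cells k x : k < N -> parab k.+1 x -> cells k x.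
Proof.
elim: k x => [|k IHk] x kN; apply: cells_step => // k' [<-] h.
by apply: IHk; apply: ltnW.
Qed.

(** The pure braid in which strand [k] winds once around all lower strands. *)
Fixpoint strand_twist k : G :=
  if k is k'.+1 then s k' * strand_twist k' * s k' else 1.

(** The square of the Garside element of [H_k], built one strand at a time. *)
Fixpoint full_twist k : G :=
  if k is k'.+1 then full_twist k' * strand_twist k else 1.

Lemma strand_twist_bands k : bands k (strand_twist k).
Proof.
elim: k => [|k IHk] /=; first exact: gen_one.
have -> : s k * strand_twist k * s k = strand_twist k ^ (s k)^-1 * s k ^+ 2.
  by rewrite conjgE invgK expg2 !mulgA mulgVK.
by apply: gen_mul; [apply: bandsS_conjV | apply: bandsS_sqr].
Qed.

Lemma full_twist_parab k : parab k (full_twist k).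
Proof.
elim: k => [|k IHk] /=; first exact: gen_one.
apply: gen_mul (parab_le (leqnSn k) IHk) _.
exact/(bands_parab (strand_twist_bands k.+1)).
Qed.

(** The last strand, going around all others, does not see how they are braided.
    The last generator of [H_k] is carried through the four outer letters of the
    strand twist by two braid relations; the other ones commute with the two
    outermost letters. *)
Lemma strand_twist_commute k x :
  k < N -> parab k x -> commute (strand_twist k.+1) x.
Proof.
move=> kN; apply: gen_commute => {x} _ [i ik ->]; apply/commute_sym.
elim: k kN i ik => // k IHk kN i; rewrite ltnS leq_eqVlt => /predU1P[->|ik].
  have sD : commute (s k.+1) (strand_twist k).
    by apply: parab_commute (bands_parab (strand_twist_bands k)).
  have st := s_near kN; rewrite /commute /=.
  transitivity (s k * s k.+1 * s k * strand_twist k * s k * s k.+1).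
    by rewrite !mulgA.
  rewrite st.
  transitivity (s k.+1 * s k * (s k.+1 * strand_twist k) * s k * s k.+1).
    by rewrite !mulgA.
  rewrite sD.
  transitivity (s k.+1 * s k * strand_twist k * (s k.+1 * s k * s k.+1)).
    by rewrite !mulgA.
  by rewrite -st !mulgA.
have si : commute (s i) (s k.+1) by apply: s_far.
apply: commuteM si; apply: commuteM; first by apply: s_far.
by apply: IHk => //; apply: ltnW.
Qed.

(** For the last generator [t] of [H_k], let [D] be the strand twist just below:
    the last two factors are [D * (t * D * t)].  As [t * D * t] is the next
    strand twist, it commutes with [D], so [t] commutes with the product. *)
Lemma full_twist_central k x : k <= N -> parab k x -> commute (full_twist k) x.
Proof.
move=> kN; apply: gen_commute => {x} _ [i ik ->]; apply/commute_sym.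
elim: k kN i ik => // k IHk kN i; rewrite ltnS leq_eqVlt.
have kN' := ltnW kN; case/predU1P => [->{i}|ik]; last first.
  apply: commuteM; first exact: IHk.
  by apply/commute_sym/strand_twist_commute/parab_s.
case: k kN {IHk kN'} => [|k] kN.
  by rewrite /commute /= !mul1g mulg1 mulgA.
have sF : commute (s k.+1) (full_twist k).
  exact: parab_commute (full_twist_parab k).
rewrite [full_twist _]/= -mulgA; apply: commuteM => //.
set D := s k * _ * _; set t := s k.+1.
have DD : commute (t * D * t) D.
  apply: (@strand_twist_commute k.+1) => //.
  exact/(bands_parab (strand_twist_bands k.+1)).
by move: DD; rewrite /commute !mulgA => ->.
Qed.

End BraidRelations.

(** * The generators of the braid group *)

Section Generators.

Variable n : nat.

(** Indexing by natural numbers makes the generators of [B_n] an instance of the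
    preceding part; out of range the value 1 keeps distant ones commuting. *)
Definition sgen (i : nat) : braid n :=
  if insub i is Some j then sigma (j : 'I_n.-1) else 1.

Lemma sgenE (i : 'I_n.-1) : sgen i = sigma i.
Proof. by rewrite /sgen valK. Qed.

Lemma sgen_ord i (i_lt : i < n.-1) : sgen i = sigma (Ordinal i_lt).
Proof. by rewrite -sgenE. Qed.

Lemma sgen_out i : n.-1 <= i -> sgen i = 1.
Proof. by rewrite leqNgt /sgen => /negP; case: insubP => [? ->|]. Qed.

Lemma sgen_far i j : i.+1 < j -> commute (sgen i) (sgen j).
Proof.
move=> ij; case: (ltnP j n.-1) => [jn|/sgen_out ->]; last exact: commute1.
have i_lt : i < n.-1 by lia.
rewrite !sgen_ord /commute [_ * _]braid_mulE [RHS]braid_mulE.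
exact/braid_of_eq/braid_eq_far.
Qed.

Lemma sgen_near i : i.+1 < n.-1 ->
  sgen i * sgen i.+1 * sgen i = sgen i.+1 * sgen i * sgen i.+1.
Proof.
move=> jn; have i_lt : i < n.-1 by lia.
rewrite !sgen_ord ![sigma _ * sigma _]braid_mulE ![braid_of _ * _]braid_mulE.
exact/braid_of_eq/braid_eq_near.
Qed.

Lemma braid_gen (x : braid n) : parab sgen n.-1 x.
Proof.
rewrite -(word_ofK x); elim: (word_of x) => [|[i b] w IHw].
  exact: gen_one.
rewrite -cat1s -braid_mulE; apply: gen_mul => //.
have Hi : parab sgen n.-1 (sigma i) by rewrite -sgenE; apply: parab_s.
case: b => //.
have -> : braid_of [:: (i, true)] = (sigma i)^-1 by rewrite [RHS]braid_invE.
exact: gen_inv.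
Qed.

End Generators.

(** * An action of the braid group on coloured strands *)

Section RackAction.

Variables (n : nat) (F : groupType).

(** Colours [(false, a)] are elements of the group [F], acting on one another by
    conjugation; colours [(true, m)] are points of the [F]-set [F], on which
    [F] acts by left translation.  Points act trivially on everything. *)
Definition colour : Type := bool * F.
Implicit Types (c : nat -> colour) (x y z : colour) (i j k : nat).

Definition rack y x : colour :=
  if y.1 then x else (x.1, if x.1 then y.2 * x.2 else x.2 ^ y.2^-1).
Definition rackV y x : colour :=
  if y.1 then x else (x.1, if x.1 then y.2^-1 * x.2 else x.2 ^ y.2).

Lemma rackK y : cancel (rack y) (rackV y).
Proof.
case: y => -[] a [] //= [] b; rewrite /rack /rackV /= ?mulKg //.
by rewrite conjgKV.
Qed.

Lemma rackKV y : cancel (rackV y) (rack y).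
Proof.
case: y => -[] a [] //= [] b; rewrite /rack /rackV /= ?mulVKg //.
by rewrite conjgK.
Qed.

(** Self-distributivity is what makes the third Reidemeister move hold. *)
Lemma rackD x y z : rack z (rack y x) = rack (rack z y) (rack z x).
Proof.
case: x y z => [[] a] [[] b] [[] d] //=; rewrite /rack //=; congr (_, _).
  by rewrite !conjgE !invgK !mulgA mulgVK.
by rewrite -!conjgM -conjVg -conjgC.
Qed.

Definition cross i c : nat -> colour := fun j =>
  if j == i then c i.+1 else if j == i.+1 then rack (c i.+1) (c i) else c j.

Definition uncross i c : nat -> colour := fun j =>
  if j == i then rackV (c i) (c i.+1) else if j == i.+1 then c i else c j.

Lemma crossK i : cancel (cross i) (uncross i).
Proof.
move=> c; apply/funext => j; rewrite /uncross /cross !eqxx.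
rewrite (gtn_eqF (ltnSn i)) rackK.
by do 2?[case: eqP => [->//|_]].
Qed.

Lemma uncrossK i : cancel (uncross i) (cross i).
Proof.
move=> c; apply/funext => j; rewrite /uncross /cross !eqxx.
rewrite (gtn_eqF (ltnSn i)) rackKV.
by do 2?[case: eqP => [->//|_]].
Qed.

Lemma cross_far i j c : i.+1 < j -> cross i (cross j c) = cross j (cross i c).
Proof.
move=> ij; apply/funext => p; rewrite /cross.
by do ![case: eqP => ?; subst => //]; lia.
Qed.

Lemma cross_near i c :
  cross i (cross i.+1 (cross i c)) = cross i.+1 (cross i (cross i.+1 c)).
Proof.
apply/funext => p; rewrite /cross.
by do ![case: eqP => ?; subst => //]; try lia; rewrite rackD.
Qed.

Definition act_letter (l : 'I_n.-1 * bool) c :=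
  if l.2 then uncross l.1 c else cross l.1 c.

Definition act_word (w : braid_word n) c := foldr act_letter c w.

Lemma act_word_eq u v : braid_eq u v -> act_word u =1 act_word v.
Proof.
rewrite /act_word; elim=> {u v} [u|u v _ IH|v u w _ IH1 _ IH2|u1 u2 v1 v2 _ IH1
  _ IH2|i b|i j lij|i j ji] c //=.
- by rewrite IH1.
- by rewrite !foldr_cat IH2 IH1.
- by rewrite /act_letter; case: b => /=; rewrite ?crossK ?uncrossK.
- exact: cross_far.
- by rewrite /act_letter /= ji cross_near.
Qed.

Definition act (b : braid n) c := act_word (word_of b) c.

Lemma act_of w c : act (braid_of w) c = act_word w c.
Proof. exact/act_word_eq/word_of_eq. Qed.

Lemma actM a b c : act (a * b) c = act a (act b c).
Proof.
by rewrite -(word_ofK a) -(word_ofK b) [_ * _]braid_mulE !act_of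
  /act_word foldr_cat.
Qed.

Lemma act1 c : act 1 c = c.
Proof. exact: act_of. Qed.

Lemma act_sgen i c : i < n.-1 -> act (sgen n i) c = cross i c.
Proof. by move=> i_lt; rewrite sgen_ord act_of. Qed.

Lemma actK b c : act b^-1 (act b c) = c.
Proof. by rewrite -actM mulVg act1. Qed.

End RackAction.

(** * Permutations and exponent sums *)

Section PermExpo.

Variable n : nat.
Local Notation s := (sgen n).
Implicit Types (x y u h : braid n) (i j k : nat).

Lemma braid_perm_parab k h (j : 'I_n) :
  k < j -> parab s k h -> braid_perm h j = j.
Proof.
move=> kj; elim=> {h} [_ [i ik ->]||x y _ IHx _ IHy|x _ IHx].
- case: (ltnP i n.-1) => [i_lt|/sgen_out ->]; last by rewrite braid_perm1 perm1.
  rewrite sgen_ord braid_perm_sigma tpermD // -val_eqE /=; lia.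
- by rewrite braid_perm1 perm1.
- by rewrite braid_permM permM IHx IHy.
- by rewrite gmulfV /= -{1}IHx permK.
Qed.

Lemma braid_perm_bands k u : bands s k u -> braid_perm u = 1.
Proof.
elim=> {u} [_ [i ik ->]||x y _ IHx _ IHy|x _ IHx].
- elim: k ik => // k IHk ik /=; case: eqP => [_|/eqP nik].
    case: (ltnP k n.-1) => [k_lt|/sgen_out ->]; last first.
      by rewrite expg1n braid_perm1.
    by rewrite sgen_ord expg2 braid_permM braid_perm_sigma tperm2.
  by rewrite gmulfJ /= IHk ?conj1g // ltn_neqAle nik.
- exact: braid_perm1.
- by rewrite braid_permM IHx IHy mulg1.
- by rewrite gmulfV /= IHx invg1.
Qed.

(** Braids of the other cell move strand [k.+1] to a lower place. *)
Lemma pure_combed k x :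
  k < n.-1 -> parab s k.+1 x -> braid_perm x = 1 -> combed s k x.
Proof.
move=> k_lt Hx x1.
case: (parab_cells (@sgen_far n) (@sgen_near n) k_lt Hx) => //.
case=> q [h [Qq Hh]].
move: x1 => /[swap] -> /permP.
have k1n : k.+1 < n by lia.
have kn : k < n by lia.
move/(_ (Ordinal k1n)); rewrite perm1 !braid_permM !permM => e.
case: Qq e => u [h' [Uu Hh' ->]].
rewrite braid_permM permM (braid_perm_bands Uu) perm1.
rewrite (@braid_perm_parab k h') // sgen_ord braid_perm_sigma.
have -> : Ordinal k1n = Ordinal (strandS_lt (Ordinal k_lt)) by apply: val_inj.
rewrite /adj_tperm tpermR => e.
have {e} := e; rewrite -[X in _ = X](@braid_perm_parab k h) // => /perm_inj.
by move/(congr1 val) => /=; lia.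
Qed.

Definition expo_word (w : braid_word n) : int :=
  (\sum_(l <- w) if l.2 then -1 else 1)%R.

Lemma expo_word_eq w1 w2 : braid_eq w1 w2 -> expo_word w1 = expo_word w2.
Proof.
rewrite /expo_word; elim=> {w1 w2} [u|u v _ ->|v u w _ -> _ ->|u1 u2 v1 v2 _ e1
  _ e2|i b|i j lij|i j ji] //; rewrite ?big_cat ?e1 ?e2 ?big_cons ?big_nil //=.
by case: b.
Qed.

Definition expo x : int := expo_word (word_of x).

Lemma expo_of w : expo (braid_of w) = expo_word w.
Proof. exact/expo_word_eq/word_of_eq. Qed.

Lemma expoM x y : expo (x * y) = (expo x + expo y)%R.
Proof.
by rewrite -(word_ofK x) -(word_ofK y) [_ * _]braid_mulE !expo_of
  /expo_word big_cat.
Qed.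

Lemma expo1 : expo 1 = 0%R.
Proof. by rewrite [LHS]expo_of /expo_word big_nil. Qed.

Lemma expoV x : expo x^-1 = (- expo x)%R.
Proof. by apply/eqP; rewrite -addr_eq0 -expoM mulVg expo1. Qed.

Lemma expoX x m : expo (x ^+ m) = (expo x *+ m)%R.
Proof.
by elim: m => [|m IHm]; rewrite ?expo1 // expgS expoM IHm mulrS.
Qed.

Lemma expoJ x y : expo (x ^ y) = expo x.
Proof. by rewrite conjgE !expoM expoV addrC addrK. Qed.

Lemma expo_sgen i : i < n.-1 -> expo (s i) = 1%R.
Proof. by move=> i_lt; rewrite sgen_ord expo_of /expo_word big_seq1. Qed.

Lemma expo_band k i : k <= n.-1 -> i < k -> expo (band s k i) = 2%R.
Proof.
elim: k => // k IHk k_lt ik /=; case: eqP => [_|nik].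
  by rewrite expoX expo_sgen.
by rewrite expoJ IHk //; lia.
Qed.

Lemma expo_strand_twist k : k <= n.-1 -> expo (strand_twist s k) = Posz (k * 2).
Proof.
elim: k => [|k IHk] k_lt; first exact: expo1.
by rewrite /= !expoM expo_sgen // IHk ?(ltnW k_lt) //; lia.
Qed.

Lemma expo_full_twist k : k <= n.-1 -> expo (full_twist s k) = Posz (k * k.+1).
Proof.
elim: k => [|k IHk] k_lt; first exact: expo1.
rewrite -[full_twist s k.+1]/(full_twist s k * strand_twist s k.+1).
by rewrite expoM expo_strand_twist // IHk ?(ltnW k_lt) //; lia.
Qed.

(** The braid relations make a homomorphism to an abelian group constant on the
    generators. *)
Lemma additive_expo (phi : braid n -> int) :
    (forall x y, phi (x * y) = (phi x + phi y)%R) ->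
  forall x, phi x = (phi (s 0) * expo x)%R.
Proof.
move=> phiM.
have phi1 : phi 1 = 0%R by apply: (addIr (phi 1)); rewrite -phiM mulg1 add0r.
have phiV x : phi x^-1 = (- phi x)%R.
  by apply/eqP; rewrite -addr_eq0 -phiM mulVg phi1.
move=> x; elim: (braid_gen x) => {x} [_ [i ik ->]||x y _ IHx _ IHy|x _ IHx].
- rewrite expo_sgen // mulr1; elim: i ik => // i IHi ik.
  rewrite -IHi; last exact: ltnW.
  have := congr1 phi (@sgen_near n i ik); rewrite !phiM => e.
  by apply/esym; apply: (addIr (phi (s i) + phi (s i.+1))%R); lia.
- by rewrite phi1 expo1 mulr0.
- by rewrite phiM expoM mulrDr IHx IHy.
- by rewrite phiV expoV mulrN IHx.
Qed.

End PermExpo.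

(** * The universal property of the bands *)

Section Tracking.

Variables (n : nat) (F : groupType).
Local Notation s := (sgen n).
Implicit Types (c : nat -> colour F) (u h : braid n) (m w : F).

Lemma act_parab k h c j :
  k <= n.-1 -> k < j -> parab s k h -> act h c j = c j.
Proof.
move=> kn kj Hh; elim: Hh c => {h} [_ [i ik ->]||a b _ IHa _ IHb|a _ IHa] c.
- rewrite act_sgen; last exact: leq_trans kn.
  by rewrite /cross !gtn_eqF //; lia.
- by rewrite act1.
- by rewrite actM IHa IHb.
- by rewrite -{1}IHa -actM mulgV act1.
Qed.

Definition tracked k (x : nat -> F) m : nat -> colour F :=
  fun j => if j == k then (true, m) else (false, x j).

Lemma tracked_inj k x : injective (tracked k x).
Proof. by move=> m w /(congr1 (@^~ k)); rewrite /tracked eqxx => -[]. Qed.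

(** The point moves freely down to strand [i], is translated by [x i] when the
    two strands wind around each other, and moves freely back; no other strand
    notices. *)
Lemma act_band k i x m : k <= n.-1 -> i < k ->
  act (band s k i) (tracked k x m) = tracked k x (x i * m).
Proof.
elim: k i x m => // k IHk i x m kn ik.
rewrite /=; case: eqP => [->|/eqP nik].
  rewrite expg2 actM !act_sgen //; apply/funext => j.
  rewrite /cross /tracked !eqxx (gtn_eqF (ltnSn k)) (ltn_eqF (ltnSn k)) /=.
  case: eqP => [->|_];
    rewrite ?eqxx ?(ltn_eqF (ltnSn k)) ?(gtn_eqF (ltnSn k)) //.
  by rewrite /rack /=; case: eqP.
pose x' := fun j => if j == k.+1 then x k else x j.
have slide w : act (s k) (tracked k.+1 x w) = tracked k x' w.
  rewrite act_sgen //; apply/funext => j.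
  rewrite /cross /tracked /x' !eqxx (ltn_eqF (ltnSn k)) /=.
  by case: (j == k) => //; case: (j == k.+1).
rewrite conjgE !actM slide IHk ?(ltnW kn) //; last by rewrite ltn_neqAle nik.
rewrite /x' (ltn_eqF (ik : i < k.+1)) -/x'.
by rewrite -[in RHS](actK (s k) (tracked _ _ _)) slide.
Qed.

(** The graph of the homomorphism from [U_k] to [F] that sends [band k i] to
    [x i].  As a relation it can be used before knowing that it is
    single-valued, which [act_tracks] and [tracked_inj] imply. *)
Definition tracks k x : braid n * F -> Prop :=
  gen (fun p => exists2 i, i < k & p = (band s k i, x i)).

Lemma act_tracks k x p m : k <= n.-1 -> tracks k x p ->
  act p.1 (tracked k x m) = tracked k x (p.2 * m).
Proof.
move=> kn Tp; elim: Tp m => {p} [_ [i ik ->]||p q _ IHp _ IHq|p _ IHp] m /=.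
- exact: act_band.
- by rewrite act1 mul1g.
- by rewrite actM IHq IHp mulgA.
- by rewrite -{1}(mulVKg p.2 m) -IHp actK.
Qed.

Lemma bands_tracks k x u : bands s k u -> exists w, tracks k x (u, w).
Proof.
elim=> {u} [_ [i ik ->]||u v _ [w1 T1] _ [w2 T2]|u _ [w T]].
- by exists (x i); apply: gen_in; exists i.
- by exists 1; apply: (gen_one _ : tracks k x 1).
- by exists (w1 * w2); apply: (gen_mul T1 T2).
- by exists w^-1; apply: (gen_inv T).
Qed.

End Tracking.

(** * Fox derivatives modulo 2 *)

Section Lamplighter.

Variable G : groupType.

(** The semidirect product of the boolean functions on [G], with pointwise
    exclusive or, by [G] acting through translations.  A homomorphism to it is a
    homomorphism [phi] to [G] together with a derivation along [phi]. *)
Definition lamplighter : Type := ((G -> bool) * G)%type.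
HB.instance Definition _ := gen_eqMixin lamplighter.
HB.instance Definition _ := gen_choiceMixin lamplighter.

Implicit Types a b c : lamplighter.

Definition lamp_mul a b : lamplighter :=
  (fun v => a.1 v (+) b.1 (a.2^-1 * v), a.2 * b.2).
Definition lamp_one : lamplighter := (xpred0, 1).
Definition lamp_inv a : lamplighter := (fun v => a.1 (a.2 * v), a.2^-1).

Lemma lamp_mulA : associative lamp_mul.
Proof.
move=> a b c; congr (_, _) => /=; last by rewrite mulgA.
by apply/funext => v; rewrite addbA invgM mulgA.
Qed.

Lemma lamp_mul1 : left_id lamp_one lamp_mul.
Proof.
move=> [h u]; congr (_, _) => /=; last by rewrite mul1g.
by apply/funext => v; rewrite invg1 mul1g.
Qed.

Lemma lamp_mulr1 : right_id lamp_one lamp_mul.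
Proof.
move=> [h u]; congr (_, _) => /=; last by rewrite mulg1.
by apply/funext => v; rewrite addbF.
Qed.

Lemma lamp_mulV : left_inverse lamp_one lamp_inv lamp_mul.
Proof.
move=> a; congr (_, _) => /=; last by rewrite mulVg.
by apply/funext => v; rewrite invgK addbb.
Qed.

Lemma lamp_mulrV : right_inverse lamp_one lamp_inv lamp_mul.
Proof.
move=> a; congr (_, _) => /=; last by rewrite mulgV.
by apply/funext => v; rewrite mulVKg addbb.
Qed.

HB.instance Definition _ := isGroup.Build lamplighter
  lamp_mulA lamp_mul1 lamp_mulr1 lamp_mulV lamp_mulrV.

End Lamplighter.

(** * The center of the pure braid group *)

Section Center.

Variable n : nat.
Local Notation s := (sgen n).
Implicit Types (x y z u h : braid n) (i j k : nat).

(** The Fox derivative with respect to [band k 1]: the first component is the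
    indicator function of the neutral element for [i = 1], and 0 otherwise. *)
Definition fox k i : lamplighter (braid n) :=
  (fun v => (i == 1%N) && (v == 1), band s k i).

(** An upper bound for the exponent sum on the support stands in for finiteness
    of the support: it already excludes the nonzero functions invariant under
    translation by an element of positive exponent sum. *)
Lemma tracks_fox k p : k <= n.-1 -> tracks k (fox k) p ->
  p.2.2 = p.1 /\ exists N : int, forall v, p.2.1 v -> (expo v <= N)%R.
Proof.
move=> kn; elim=> {p} [_ [i ik ->]||p q _ [e1 [N1 b1]] _ [e2 [N2 b2]]
  |p _ [e [N b]]]; split=> //=.
- exists 0%R => v; case/andP => _ /eqP ->; by rewrite expo1.
- by exists 0%R.
- by rewrite e1 e2.
- exists (Num.max N1 (N2 + expo p.2.2)%R) => v; rewrite le_max.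
  case ev : (p.2.1 v) => /=; first by rewrite b1.
  move/b2; rewrite expoM expoV => le; apply/orP; right; lia.
- by rewrite e.
- by exists (N - expo p.2.2)%R => v /b; rewrite expoM lerBrDr addrC.
Qed.

(** A braid of [H_k] does not touch the point carried by strand [k.+1], while
    [u] in [U_(k+1)] translates it by an element whose second component is
    [u]. *)
Lemma bands_parab_trivial k u :
  k < n.-1 -> bands s k.+1 u -> parab s k u -> u = 1.
Proof.
move=> kn Uu Hu; have [w T] := bands_tracks (fox k.+1) Uu.
have := act_tracks 1 kn T; move/(congr1 (@^~ k.+1)).
rewrite /= (act_parab _ (ltnW kn) (ltnSn k) Hu) /tracked eqxx mulg1 => -[ew].
by have [/= <- _] := tracks_fox kn T; rewrite -ew.
Qed.

(** Let [w] be the translation by which [u] acts.  Since [w] commutes with the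
    image [(0, a_0)] of the first band, its derivative is invariant under
    translation by [a_0], so it vanishes, being supported in bounded exponent
    sums.  Commuting with [(delta_1, a_1)] then says that [u] fixes the
    indicator function of 1. *)
Lemma bands_center_trivial k u : 1 < k -> k <= n.-1 -> bands s k u ->
  (forall i, i < k -> commute u (band s k i)) -> u = 1.
Proof.
move=> k1 kn Uu uC; have [w T] := bands_tracks (fox k) Uu.
have wC i : i < k -> w * fox k i = fox k i * w.
  move=> ik; apply: (@tracked_inj _ k (fox k)).
  rewrite -(act_tracks _ kn T) /= -[in LHS](mulg1 (fox k i)).
  rewrite -(act_band _ _ kn ik).
  by rewrite -actM uC // actM (act_tracks _ kn T) (act_band _ _ kn ik) mulg1.
have [/= <- [N bN]] := tracks_fox kn T.
have k0 : 0 < k by exact: ltnW.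
have dV v : w.1 (band s k 0 * v) = w.1 v.
  have /(congr1 fst)/(congr1 (@^~ (band s k 0 * v))) := wC 0%N k0.
  by rewrite /= addbF mulKg.
have d0 v : w.1 v = false.
  have shift m : w.1 (band s k 0 ^+ m * v) = w.1 v.
    by elim: m => [|m IHm]; rewrite ?mul1g // expgS -mulgA dV.
  case dv : (w.1 v) => //.
  have := bN (band s k 0 ^+ (absz (N - expo v)%R).+1 * v).
  rewrite shift expoM expoX expo_band // => /(_ dv); lia.
have /(congr1 fst)/(congr1 (@^~ 1)) := wC 1%N k1.
rewrite /= !d0 mulg1 eqxx addbF addFb => /eqP e.
by apply: invg_inj; rewrite e invg1.
Qed.

(** The same power of the next full twist will do: the two full twists differ
    by a strand twist, which commutes with both. *)
Lemma full_twist_bands k x : k < n.-1 -> gen (eq (full_twist s k)) x ->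
  exists2 y, gen (eq (full_twist s k.+1)) y & bands s k.+1 (x^-1 * y).
Proof.
move=> kn; set F := full_twist s k; set D := strand_twist s k.+1.
have -> : full_twist s k.+1 = F * D by [].
have FD m : commute (F ^+ m) (D ^+ m).
  apply/commuteX2/commute_sym.
  apply: (strand_twist_commute (@sgen_far n) (@sgen_near n) kn).
  exact: full_twist_parab.
have FDm m : (F * D) ^+ m = F ^+ m * D ^+ m by apply: expgMn; apply: (FD 1%N).
have UD m : bands s k.+1 (D ^+ m) by apply/gen_exp/strand_twist_bands.
have gFD m : gen (eq (F * D)) ((F * D) ^+ m) by apply/gen_exp/gen_in.
case/gen_cycle => m [] ->.
  by exists ((F * D) ^+ m); rewrite // FDm mulKg.
exists ((F * D) ^- m); first exact: gen_inv.
by rewrite FDm FD invgM invgK mulVKg; apply: gen_inv (UD m).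
Qed.

(** Induction on [k] by combing [z = u * w].  In the base case, [H_1] is cyclic
    and the full twist is [s 0 ^+ 2]. *)
Lemma pure_center k z : 0 < k <= n.-1 -> parab s k z -> braid_perm z = 1 ->
    (forall p, parab s k p -> braid_perm p = 1 -> commute z p) ->
  gen (eq (full_twist s k)) z.
Proof.
case: k => // k; elim: k z => [|k IHk] z kn Hz z1 zC.
  have [u [h [Uu Hh ->]]] := pure_combed kn Hz z1.
  have -> : h = 1.
    by elim: Hh => {h} [_ []||_ _ _ -> _ ->|_ _ ->] //; rewrite ?mulg1 ?invg1.
  rewrite mulg1; apply: gen_sub Uu => _ [[|//] _ ->]; apply: gen_in.
  by rewrite /= mulg1 mul1g.
have kn' : k.+1 < n.-1 by [].
have [u [w [Uu Hw zE]]] := pure_combed kn Hz z1.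
have u1 := braid_perm_bands Uu.
have w1 : braid_perm w = 1 by move: z1; rewrite zE braid_permM u1 mul1g.
have Ucomm v : bands s k.+2 v -> commute z v.
  by move=> Uv; apply: zC; [apply: bands_parab | apply: braid_perm_bands Uv].
have normal p v : parab s k.+1 p -> bands s k.+2 v -> bands s k.+2 (v ^ p).
  exact: (parab_normal (@sgen_far n) (@sgen_near n) kn').
have {}IHk : gen (eq (full_twist s k.+1)) w.
  apply: IHk => // [|p Hp p1]; first exact: ltnW.
  apply/commgP/eqP/(bands_parab_trivial kn'); last first.
    by rewrite commgEl; apply: gen_mul; [apply: gen_inv | apply: gen_conj].
  have zp : z ^ p = z.
    by apply/commute_conj/zC => //; apply: parab_le Hp.
  have Uup : bands s k.+2 (u * (u ^ p)^-1).
    by apply: gen_mul => //; apply/gen_inv/normal.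
  (* The braids [w] and [u^-1] differ by [z], which commutes with [p]. *)
  suff -> : [~ w, p] = u * (u ^ p)^-1 by [].
  have wE : w = u^-1 * z by rewrite zE mulKg.
  rewrite commgEl wE conjMg conjVg zp invgM invgK.
  rewrite -mulgA (mulgA u) -(Ucomm _ Uup).
  by rewrite mulKg.
have [y Fy Uy] := full_twist_bands kn' IHk.
suff t1 : z^-1 * y = 1 by rewrite -[z]mulg1 -t1 mulVKg.
apply: (bands_center_trivial _ kn) => // [|i ik].
  have -> : z^-1 * y = (u^-1) ^ w * (w^-1 * y).
    by rewrite zE conjgE invgM !mulgA mulgK.
  by apply: gen_mul => //; apply: normal => //; apply: gen_inv.
have Ub : bands s k.+2 (band s k.+2 i) by apply: gen_in; exists i.
apply/commute_sym/commuteM; first exact/commuteV/commute_sym/Ucomm.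
apply: gen_commute Fy => _ <-; apply/commute_sym.
apply: (full_twist_central (@sgen_far n) (@sgen_near n) kn).
exact: bands_parab.
Qed.

End Center.

Lemma pure_centerE n (z : pure_braid n) : 2 <= n -> gcenter z ->
  gen (eq (full_twist (sgen n) n.-1)) (val z).
Proof.
move=> n2 zC; apply: pure_center; rewrite ?leqnn ?andbT; first by lia.
- exact: braid_gen.
- exact/eqP/(valP z).
move=> p _ /eqP p1.
have pP : p \in @pure_pred n by [].
by have := congr1 val (zC (Sub p pP)); rewrite !valM SubK.
Qed.

Lemma expo_center n (z : pure_braid n) : 2 <= n -> gcenter z ->
  exists m : int, expo (val z) = (m * Posz (n.-1 * n))%R /\ (m = 0%R -> z = 1).
Proof.
move=> n2 zC; have [m zE] := gen_cycle (pure_centerE n2 zC).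
have eF : expo (full_twist (sgen n) n.-1) = Posz (n.-1 * n).
  by rewrite expo_full_twist // prednK //; lia.
case: zE => e.
  exists (Posz m); split; first by rewrite e expoX eF; lia.
  by move=> [m0]; apply: val_inj; rewrite e m0 expg0.
exists (- Posz m)%R; split; first by rewrite e expoV expoX eF; lia.
move=> m0; have {}m0 : m = 0%N by lia.
by apply: val_inj; rewrite e m0 expg0 invg1.
Qed.

(** * Extending central automorphisms *)

Lemma automorphism_expo n (g : braid n -> braid n) : 1 < n -> automorphism g ->
  exists2 eps : int, (eps = 1 \/ eps = -1)%R &
    forall x, expo (g x) = (eps * expo x)%R.
Proof.
move=> n1 [gM [g' gK g'K]].
have ge := @additive_expo n (fun x => expo (g x)).
exists (expo (g (sgen n 0))); last by apply: ge => x y; rewrite gM expoM.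
have := ge (fun x y => etrans (congr1 (@expo n) (gM x y)) (expoM _ _))
  (g' (sgen n 0)).
rewrite g'K {1}expo_sgen; last by lia.
move/(congr1 absz)/esym/eqP; rewrite abszM muln_eq1 => /andP[/eqP + _].
by move: (expo _) => a; lia.
Qed.

Theorem theorem6p6 (n : nat) (n_ge3 : 3 <= n)
    (f : pure_braid n -> pure_braid n) :
  central_automorphism f -> f <> idfun -> ~ extends_to_braid f.
Proof.
move=> [_ fC] fN [g gA gf]; apply: fN; apply/funext => x /=.
have n1 : 1 < n by apply: ltnW.
have [eps epsE ge] := automorphism_expo n1 gA.
have fE y : exists2 z, gcenter z & f y = y * z.
  have : gcoset (f y) (@gcenter _) (f y).
    by exists 1; rewrite /= ?mulg1 // => t; apply/commute_sym/commute1.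
  by rewrite fC => -[z zC <-]; exists z.
have key y : exists m : int,
    ((eps - 1) * expo (val y) = m * Posz (n.-1 * n))%R /\ (m = 0%R -> f y = y).
  have [z zC fy] := fE y; have [m [em m0]] := expo_center n1 zC.
  exists m; split; last by move/m0 => z1; rewrite fy z1 mulg1.
  by rewrite -em mulrBl mul1r -ge gf fy valM expoM addrAC subrr add0r.
have [m [em m0]] := key x; apply: m0.
have [eps1|epsN1] := epsE.
  move: em; rewrite eps1 subrr mul0r => /esym/eqP.
  by rewrite mulf_eq0 => /orP[/eqP //|/eqP]; nia.
have s2P : sgen n 0 ^+ 2 \in @pure_pred n.
  rewrite inE; apply/eqP/(@braid_perm_bands n 1)/bandsS_sqr.
(* The central factor of [f] at [s_0 ^+ 2] has exponent sum -4. *)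
have [p [ep _]] := key (Sub (sgen n 0 ^+ 2) s2P).
move: ep; rewrite SubK expoX expo_sgen; last by lia.
rewrite epsN1 => /(congr1 absz); rewrite -[LHS]/4%N abszM /=.
have : 2 * 3 <= n.-1 * n by apply: leq_mul; lia.
by case: (absz p) => [|q]; rewrite ?mulSn {em}; lia.
Qed.
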